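(* The GNR-surface $F_{(\alpha,q_n)}$ is minimal if and only if the equality $$\frac{f}{g}=\frac{-a_2\kappa g+a_2\tau(a_2'+a_1\tau)+u\left(-f'+a_1\tau(a_1'-a_2\tau)\right)}{u\left(g'-u\kappa(a_1'-a_2\tau)\right)}$$ is satisfied.
   Context: Let $\alpha:I\subset\mathbb{R}\to\mathbb{R}^3$ be a unit speed curve with arclength parameter $s$, Frenet frame $\{\vec T,\vec N,\vec B\}$, curvature $\kappa$ and torsion $\tau$, so that $\vec T=\vec\alpha'$, $\vec T'=\kappa\vec N$, $\vec N'=-\kappa\vec T+\tau\vec B$, $\vec B'=-\tau\vec N$. Let $a_1,a_2$ be smooth functions of $s$ with $a_1^2+a_2^2=1$. The generalized normal ruled surface (GNR-surface) of $\alpha$ is $\vec F_{(\alpha,q_n)}(s,u)=\vec\alpha(s)+u\,\vec q_n(s)$, $(s,u)\in I\times\mathbb{R}$, with ruling $\vec q_n(s)=a_1(s)\vec N(s)+a_2(s)\vec B(s)$. Its characterization functions are $f(s)=a_1'(s)a_2(s)-a_1(s)a_2'(s)-\tau(s)$ and $g(s,u)=1-u\,a_1(s)\kappa(s)$. A prime denotes the derivative with respect to $s$ (for $g$, the partial derivative). A surface is called minimal if its mean curvature $H=\frac{EN-2FM+GL}{2(EG-F^2)}$ vanishes at all points of the surface, where $E,F,G$ and $L,M,N$ are the coefficients of the first and second fundamental forms $E\,ds^2+2F\,ds\,du+G\,du^2$ and $L\,ds^2+2M\,ds\,du+N\,du^2$.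
   Formalization: The equality is required only where both denominators are nonzero, and it is assumed that such (s,u) are dense in I×R; surfaces whose right-hand denominator vanishes on an open set (e.g. helicoids, some cones), where the quotient is undefined, are excluded. Minimality is tested at regular points. *)

(* Defs.v *)
From HB Require Import structures.
From mathcomp Require Import all_boot all_order all_algebra.
From mathcomp Require Import all_classical all_reals all_analysis.
Set Implicit Arguments.
Unset Strict Implicit.
Unset Printing Implicit Defensive.
Import Order.TTheory GRing.Theory Num.Theory.
Import numFieldNormedType.Exports.
Local Open Scope classical_set_scope.
Local Open Scope ring_scope.

Section Euclidean.
Context {R : realType}.
Implicit Types v w : 'rV[R]_3.

Definition dotv v w : R := \sum_(i < 3) v 0 i * w 0 i.

(* The library norm on 'rV[R]_3 is the sup norm, hence this definition. *)
Definition enorm v : R := Num.sqrt (dotv v v).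

Definition crossv v w : 'rV[R]_3 :=
  let x (k : nat) : R := v 0 (inord k) in
  let y (k : nat) : R := w 0 (inord k) in
  \row_(i < 3) [:: x 1%N * y 2%N - x 2%N * y 1%N;
                   x 2%N * y 0%N - x 0%N * y 2%N;
                   x 0%N * y 1%N - x 1%N * y 0%N]`_i.

End Euclidean.

(* C^oo on I. Meaningful for open I, where derivatives at points of I only
   depend on the values of f on I. *)
Definition smooth_on {R : realType} {V : normedModType R}
    (I : set R) (f : R -> V) : Prop :=
  forall (n : nat) (s : R), I s -> derivable (derive1n n f) s 1.

Section Frenet.
Context {R : realType}.
Variable alpha : R -> 'rV[R]_3.

Definition unit_speed_on (I : set R) : Prop :=
  forall s, I s -> enorm (derive1 alpha s) = 1.

Definition tangent : R -> 'rV[R]_3 := derive1 alpha.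
Definition curvature (s : R) : R := enorm (derive1 tangent s).
Definition normal (s : R) : 'rV[R]_3 := (curvature s)^-1 *: derive1 tangent s.
Definition binormal (s : R) : 'rV[R]_3 := crossv (tangent s) (normal s).
(* Sign convention: B' = - tau N. *)
Definition torsion (s : R) : R := - dotv (derive1 binormal s) (normal s).

End Frenet.

Section FundamentalForms.
Context {R : realType}.
Variable F : R -> R -> 'rV[R]_3.

Definition pd1 (G : R -> R -> 'rV[R]_3) (s u : R) : 'rV[R]_3 :=
  derive1 (fun t => G t u) s.
Definition pd2 (G : R -> R -> 'rV[R]_3) (s u : R) : 'rV[R]_3 :=
  derive1 (fun t => G s t) u.

Definition unit_normal (s u : R) : 'rV[R]_3 :=
  let w := crossv (pd1 F s u) (pd2 F s u) in (enorm w)^-1 *: w.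

Definition ffE (s u : R) : R := dotv (pd1 F s u) (pd1 F s u).
Definition ffF (s u : R) : R := dotv (pd1 F s u) (pd2 F s u).
Definition ffG (s u : R) : R := dotv (pd2 F s u) (pd2 F s u).
Definition ffL (s u : R) : R := dotv (pd1 (pd1 F) s u) (unit_normal s u).
Definition ffM (s u : R) : R := dotv (pd2 (pd1 F) s u) (unit_normal s u).
Definition ffN (s u : R) : R := dotv (pd2 (pd2 F) s u) (unit_normal s u).

Definition regular_at (s u : R) : Prop :=
  ffE s u * ffG s u - ffF s u ^+ 2 != 0.

Definition mean_curvature (s u : R) : R :=
  (ffE s u * ffN s u - 2 * ffF s u * ffM s u + ffG s u * ffL s u)
  / (2 * (ffE s u * ffG s u - ffF s u ^+ 2)).

(* The unit normal, hence H, only exists at regular points. *)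
Definition minimal_on (D : set (R * R)) : Prop :=
  forall s u, D (s, u) -> regular_at s u -> mean_curvature s u = 0.

End FundamentalForms.

Section GNRSurface.
Context {R : realType}.
Variables (alpha : R -> 'rV[R]_3) (a1 a2 : R -> R).

Definition gnr_ruling (s : R) : 'rV[R]_3 :=
  a1 s *: normal alpha s + a2 s *: binormal alpha s.

Definition gnr_surface (s u : R) : 'rV[R]_3 := alpha s + u *: gnr_ruling s.

Definition gnr_f (s : R) : R :=
  derive1 a1 s * a2 s - a1 s * derive1 a2 s - torsion alpha s.

Definition gnr_g (s u : R) : R := 1 - u * a1 s * curvature alpha s.

Definition gnr_num (s u : R) : R :=
  - (a2 s * curvature alpha s * gnr_g s u)
  + a2 s * torsion alpha s * (derive1 a2 s + a1 s * torsion alpha s)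
  + u * (- derive1 gnr_f s
         + a1 s * torsion alpha s * (derive1 a1 s - a2 s * torsion alpha s)).

Definition gnr_den (s u : R) : R :=
  u * (derive1 (fun t => gnr_g t u) s
       - u * curvature alpha s * (derive1 a1 s - a2 s * torsion alpha s)).

(* The parameters at which both quotients in
   gnr_f / gnr_g = gnr_num / gnr_den have nonzero denominators. Note that
   gnr_den always vanishes at u = 0. *)
Definition gnr_defined (s u : R) : Prop :=
  gnr_g s u != 0 /\ gnr_den s u != 0.

End GNRSurface.

(* Main.v *)
Require Import Defs.
From HB Require Import structures.
From mathcomp Require Import all_boot all_order all_algebra.
From mathcomp Require Import all_classical all_reals all_analysis.
From mathcomp Require Import ring lra.
Import Order.TTheory GRing.Theory Num.Theory.
Import numFieldNormedType.Exports.
Local Open Scope classical_set_scope.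
Local Open Scope ring_scope.

(** Write [q] for the ruling, [C = a2 N - a1 B], [k] and [t] for curvature and
    torsion. The orthonormal frame [T, q, C] is adapted to the surface: it obeys
    T' = k (a1 q + a2 C), q' = - a1 k T + f C and C' = - a2 k T - f q, so that
    the parametrization has first derivatives g T + u f C and q. Hence F = 0,
    G = 1, the second derivative in u vanishes, and the mean curvature is zero
    exactly when L is. Computing L turns minimality into
    f den = g (a2 k g + u f') for all s in I and all u ([gnr_minimalP]), where
    den, the denominator in the quotient criterion, equals - u^2 delta with
    delta = (a1 k)' + k a2 f ([gnr_denE]).

    In the same notation the quotient criterion reads f den = g num, with
    num = - (a2 k g + u f') + (u - 1) a1 a2 t f. This is a different equation,
    so the equivalence is not obtained by rearranging terms: it is a matter of
    rigidity. At fixed s, both equations are polynomial in u, and comparing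
    coefficients makes each of them very restrictive.

    - Minimality gives a2 k = 0, f' = 0 and f delta = 0 ([minimal_coef_eq0]).
      Where the quotients are defined delta is nonzero, so a2 = f = f' = 0 and
      both sides of the criterion are 0.
    - The criterion, required only for those u where the quotients make sense,
      extends to all u because it is polynomial; it then gives a2 = f = 0
      wherever delta is nonzero ([quotient_coef_eq0]). By density of such
      points and continuity, a2 and f vanish on all of I
      ([closure_proj_eq0]), and the equation of [gnr_minimalP] becomes 0 = 0.

    As the quotients are generically defined, both conditions thus say that the
    curve is planar and that the surface lies in its plane. The rest is differential calculus: [nderivable_on] propagates
    smoothness to curvature, torsion and f, and the Frenet equations
    ([is_derive_tangent], [is_derive_normal], [is_derive_binormal]) are derived
    from unit speed. *)

Set Implicit Arguments.
Unset Strict Implicit.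
Unset Printing Implicit Defensive.

(** * Smooth functions on an open set *)

(** Smoothness asks for every order at once, which gives induction no hold on
    products or quotients; cut at order [n], the Leibniz, inverse and square
    root rules all go by induction on [n]. *)
Fixpoint nderivable_on {R : realType} {V : normedModType R} (I : set R)
    (n : nat) (f : R -> V) : Prop :=
  if n is m.+1
  then (forall s, I s -> derivable f s 1) /\ nderivable_on I m (derive1 f)
  else True.

Section Smooth.
Context {R : realType} {I : set R}.
Hypothesis I_open : open I.

Lemma smooth_onP {V : normedModType R} (f : R -> V) :
  smooth_on I f <-> forall n, nderivable_on I n f.
Proof.
split=> [sf n|Cf n].
  have : forall m s, I s -> derivable (derive1n m f) s 1 by exact: sf.
  elim: n f {sf} => //= n IH f sf; split=> [s Is|]; first exact: (sf 0%N).
  by apply: IH => m s Is; rewrite -derive1Sn; exact: sf.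
elim: n f Cf => [|n IH] f Cf s Is; first exact: (Cf 1%N).1.
by rewrite derive1Sn; apply: IH => // m; exact: (Cf m.+1).2.
Qed.

Lemma near_eq_on {T : Type} (f g : R -> T) (s : R) :
  {in I, f =1 g} -> I s -> \near s, f s = g s.
Proof.
move=> fg Is; near=> t; apply: fg; rewrite inE; near: t.
exact: open_nbhs_nbhs.
Unshelve. all: by end_near. Qed.

Lemma is_derive_eq_on {V : normedModType R} (f g : R -> V) (s : R) (df : V) :
  {in I, f =1 g} -> I s -> is_derive s 1 f df -> is_derive s 1 g df.
Proof. by move=> fg Is; apply: near_eq_is_derive; exact: near_eq_on. Qed.

Lemma derive1_eq_on {V : normedModType R} (f g : R -> V) :
  {in I, f =1 g} -> {in I, derive1 f =1 derive1 g}.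
Proof.
move=> fg s; rewrite inE => Is; rewrite !derive1E.
exact: near_eq_derive (near_eq_on fg Is).
Qed.

Lemma nderivable_eq_on {V : normedModType R} n (f g : R -> V) :
  {in I, f =1 g} -> nderivable_on I n f -> nderivable_on I n g.
Proof.
elim: n f g => //= n IH f g fg [df Cf]; split=> [s Is|].
  exact: near_eq_derivable (near_eq_on fg Is) (df s Is).
exact: IH (derive1_eq_on fg) Cf.
Qed.

(** The induction step of all closure rules below: a formula for the derivative,
    valid on the open set only, suffices to gain one order. *)
Lemma nderivable_is_derive {V : normedModType R} n (f df : R -> V) :
  (forall s, I s -> is_derive s 1 f (df s)) ->
  nderivable_on I n df -> nderivable_on I n.+1 f.
Proof.
move=> fdf Cdf; split=> [s Is|]; first by case: (fdf s Is).
apply: nderivable_eq_on Cdf => s; rewrite inE => Is.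
by rewrite derive1E; have [_ ->] := fdf s Is.
Qed.

Lemma nderivableW {V : normedModType R} n (f : R -> V) :
  nderivable_on I n.+1 f -> nderivable_on I n f.
Proof. by elim: n f => //= n IH f [df Cf]; split => //; exact: IH. Qed.

Lemma is_derive_derive1 {V : normedModType R} (f : R -> V) s :
  derivable f s 1 -> is_derive s 1 f (derive1 f s).
Proof. by move=> df; rewrite derive1E; exact: derivableP. Qed.

Implicit Types (f g : R -> R^o) (s : R).

Lemma is_derive_mul f g s (df dg : R^o) :
  is_derive s 1 f df -> is_derive s 1 g dg ->
  is_derive s 1 (fun t => f t * g t : R^o) (df * g s + f s * dg).
Proof.
move=> fd gd; apply: is_derive_eq; rewrite /GRing.scale /=; ring.
Qed.

Lemma is_derive_inv f s (df : R^o) : f s != 0 ->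
  is_derive s 1 f df -> is_derive s 1 (fun t => (f t)^-1 : R^o)
    (- (df * ((f s)^-1 * (f s)^-1))).
Proof.
move=> f0 [fd <-]; split; first exact: derivableV.
rewrite deriveV // /GRing.scale /= expr2 invfM; ring.
Qed.

Lemma is_derive_sqrt f s (df : R^o) : 0 < f s ->
  is_derive s 1 f df -> is_derive s 1 (fun t => Num.sqrt (f t) : R^o)
    (df * (2^-1 * (Num.sqrt (f s))^-1)).
Proof.
move=> f0 fd; rewrite mulrC -invfM.
by apply: (@is_derive1_comp _ Num.sqrt f); exact: is_derive1_sqrt.
Qed.

Lemma is_derive_const_on (f : R -> R^o) (c : R^o) s :
  (forall t, I t -> f t = c) -> I s -> is_derive s 1 f (0 : R^o).
Proof.
move=> fc Is; apply: (@is_derive_eq_on _ (fun=> c)) => // t.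
by rewrite inE => It; rewrite fc.
Qed.

Lemma nderivable_cst n (c : R^o) : nderivable_on I n (fun=> c).
Proof.
elim: n c => // n IH c.
apply (nderivable_is_derive (V := R^o) (df := fun=> 0)) => // s _.
exact: is_derive_cst.
Qed.

Lemma nderivableD {V : normedModType R} n (f g : R -> V) :
  nderivable_on I n f -> nderivable_on I n g ->
  nderivable_on I n (fun t => f t + g t).
Proof.
elim: n f g => // n IH f g [df Cf] [dg Cg].
apply (nderivable_is_derive
  (df := fun t => derive1 f t + derive1 g t)) => [s Is|].
  by apply: is_deriveD; apply: is_derive_derive1; auto.
exact: IH.
Qed.

Lemma nderivableN {V : normedModType R} n (f : R -> V) :
  nderivable_on I n f -> nderivable_on I n (fun t => - f t).
Proof.
elim: n f => // n IH f [df Cf].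
apply (nderivable_is_derive (df := fun t => - derive1 f t)) => [s Is|].
  by apply: is_deriveN; apply: is_derive_derive1; auto.
exact: IH.
Qed.

Lemma nderivableM n f g :
  nderivable_on I n f -> nderivable_on I n g ->
  nderivable_on I n (fun t => f t * g t : R^o).
Proof.
elim: n f g => // n IH f g Cf Cg; have [[df Cf'] [dg Cg']] := (Cf, Cg).
apply (nderivable_is_derive (V := R^o)
  (df := fun t => derive1 f t * g t + f t * derive1 g t : R^o)) => [s Is|].
  by apply: is_derive_mul; apply: is_derive_derive1; auto.
by apply: nderivableD; apply: IH => //; exact: nderivableW.
Qed.

Lemma nderivableV n f : (forall s, I s -> f s != 0) -> nderivable_on I n f ->
  nderivable_on I n (fun t => (f t)^-1 : R^o).
Proof.
move=> f0; elim: n => // n IH Cf; have [df Cf'] := Cf.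
apply (nderivable_is_derive (V := R^o)
  (df := fun t => - (derive1 f t * ((f t)^-1 * (f t)^-1)) : R^o)) => [s Is|].
  by apply: is_derive_inv; [exact: f0|apply: is_derive_derive1; auto].
by apply: nderivableN; apply: nderivableM => //;
  apply: nderivableM; apply: IH; exact: nderivableW.
Qed.

Lemma nderivable_sqrt n f : (forall s, I s -> 0 < f s) -> nderivable_on I n f ->
  nderivable_on I n (fun t => Num.sqrt (f t) : R^o).
Proof.
move=> f0; elim: n => // n IH Cf; have [df Cf'] := Cf.
apply (nderivable_is_derive (V := R^o)
  (df := fun t => derive1 f t * (2^-1 * (Num.sqrt (f t))^-1) : R^o)) => [s Is|].
  by apply: is_derive_sqrt; [exact: f0|apply: is_derive_derive1; auto].
apply: nderivableM => //; apply: nderivableM; first exact: nderivable_cst.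
apply: nderivableV => [s Is|]; last by apply: IH; exact: nderivableW.
by rewrite gt_eqF // sqrtr_gt0 f0.
Qed.

End Smooth.

(** * Dot and cross products in dimension three *)

Section VectorAlgebra.
Context {R : realType}.
Implicit Types (u v w : 'rV[R]_3) (a b c : R).

Lemma dotvE v w : dotv v w =
  v 0 (inord 0) * w 0 (inord 0) + v 0 (inord 1) * w 0 (inord 1)
  + v 0 (inord 2) * w 0 (inord 2).
Proof.
rewrite /dotv !big_ord_recr big_ord0 /= add0r.
by congr (v 0 _ * w 0 _ + v 0 _ * w 0 _ + v 0 _ * w 0 _); apply: val_inj;
  rewrite /= inordK.
Qed.

Lemma crossvE v w :
  (crossv v w 0 (inord 0)
   = v 0 (inord 1) * w 0 (inord 2) - v 0 (inord 2) * w 0 (inord 1)) *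
  (crossv v w 0 (inord 1)
   = v 0 (inord 2) * w 0 (inord 0) - v 0 (inord 0) * w 0 (inord 2)) *
  (crossv v w 0 (inord 2)
   = v 0 (inord 0) * w 0 (inord 1) - v 0 (inord 1) * w 0 (inord 0)).
Proof. by rewrite !mxE !inordK. Qed.

Lemma ord3P (P : 'I_3 -> Prop) :
  P (inord 0) -> P (inord 1) -> P (inord 2) -> forall i, P i.
Proof.
by move=> P0 P1 P2 i; rewrite -(inord_val i); case: i => -[|[|[|]]].
Qed.

Lemma dotvC v w : dotv v w = dotv w v.
Proof. by rewrite !dotvE; ring. Qed.

Lemma dotvDl u v w : dotv (u + v) w = dotv u w + dotv v w.
Proof. by rewrite !dotvE !mxE; ring. Qed.

Lemma dotvZl a v w : dotv (a *: v) w = a * dotv v w.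
Proof. by rewrite !dotvE !mxE; ring. Qed.

Lemma dotvDr u v w : dotv w (u + v) = dotv w u + dotv w v.
Proof. by rewrite !(dotvC w) dotvDl. Qed.

Lemma dotvZr a v w : dotv w (a *: v) = a * dotv w v.
Proof. by rewrite !(dotvC w) dotvZl. Qed.

Lemma crossvDl u v w : crossv (u + v) w = crossv u w + crossv v w.
Proof.
by apply/rowP; apply: ord3P; rewrite !(crossvE, mxE, inordK) //=; ring.
Qed.

Lemma crossvZl a v w : crossv (a *: v) w = a *: crossv v w.
Proof.
by apply/rowP; apply: ord3P; rewrite !(crossvE, mxE, inordK) //=; ring.
Qed.

Lemma crossvC v w : crossv v w = - crossv w v.
Proof.
by apply/rowP; apply: ord3P; rewrite !(crossvE, mxE, inordK) //=; ring.
Qed.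

Lemma crossvv v : crossv v v = 0.
Proof.
by apply/rowP; apply: ord3P; rewrite !(crossvE, mxE, inordK) //=; ring.
Qed.

Lemma crossv_crossv u v w :
  crossv u (crossv v w) = dotv u w *: v - dotv u v *: w.
Proof.
by apply/rowP; apply: ord3P; rewrite !(crossvE, dotvE, mxE, inordK) //=; ring.
Qed.

Lemma dotv_crossv u v w : dotv u (crossv v w) = dotv w (crossv u v).
Proof. by rewrite !(crossvE, dotvE); ring. Qed.

Lemma dotv_crossvv v w :
  dotv (crossv v w) (crossv v w) = dotv v v * dotv w w - dotv v w ^+ 2.
Proof. by rewrite !(crossvE, dotvE); ring. Qed.

Lemma crossvDr u v w : crossv w (u + v) = crossv w u + crossv w v.
Proof. by rewrite 3!(crossvC w) crossvDl opprD. Qed.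

Lemma crossvZr a v w : crossv w (a *: v) = a *: crossv w v.
Proof. by rewrite 2!(crossvC w) crossvZl scalerN. Qed.

Lemma dotvv_ge0 v : 0 <= dotv v v.
Proof. by rewrite dotvE -!expr2 !addr_ge0 ?sqr_ge0. Qed.

Lemma enorm_sqr v : enorm v ^+ 2 = dotv v v.
Proof. exact/sqr_sqrtr/dotvv_ge0. Qed.

Lemma enorm_eq0 v : (enorm v == 0) = (dotv v v == 0).
Proof. by rewrite -enorm_sqr sqrf_eq0. Qed.

(** The double cross product formula gives [v] as [dotv e3 v *: e3] plus
    [crossv e3 (crossv v e3)] for the unit vector [e3 = crossv e1 e2]; a second
    use of it expands [crossv v e3] along [e1] and [e2]. *)
Lemma orthonormal_expand (e1 e2 v : 'rV[R]_3) :
  dotv e1 e1 = 1 -> dotv e2 e2 = 1 -> dotv e1 e2 = 0 ->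
  v = dotv v e1 *: e1 + dotv v e2 *: e2
      + dotv v (crossv e1 e2) *: crossv e1 e2.
Proof.
move=> e11 e22 e12; set e3 := crossv e1 e2.
have e33 : dotv e3 e3 = 1.
  by rewrite dotv_crossvv e11 e22 e12; ring.
have ve3 : crossv v e3 = dotv v e2 *: e1 - dotv v e1 *: e2.
  exact: crossv_crossv.
have e31 : crossv e3 e1 = e2.
  by rewrite crossvC crossv_crossv e11 e12 scale0r scale1r sub0r opprK.
have e32 : crossv e3 e2 = - e1.
  by rewrite crossvC crossv_crossv (dotvC e2 e1) e22 e12 scale0r scale1r subr0.
have := crossv_crossv e3 v e3.
rewrite e33 scale1r ve3 -scaleNr crossvDr !crossvZr e31 e32.
move/eqP; rewrite eq_sym subr_eq (dotvC e3 v) => /eqP {1}->.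
by congr (_ + _); apply/rowP => i; rewrite !mxE; ring.
Qed.

End VectorAlgebra.

(** * Differentiating vector-valued functions *)

Section VectorCalculus.
Context {R : realType}.
Implicit Types (v w : R -> 'rV[R]_3) (a : R -> R^o) (s : R).

(** Reduces vector calculus to real functions, where the product rule lives. *)
Lemma is_derive_rowP v s (dv : 'rV[R]_3) :
  is_derive s 1 v dv <->
  forall i, is_derive s 1 (fun t => v t 0 i : R^o) (dv 0 i).
Proof.
split=> [[vd <-] i|vd].
  by split; [exact: (derivable_mxP _ _ _).1|rewrite derive_mx // mxE].
have dv' : derivable v s 1.
  by apply/derivable_mxP => i j; rewrite ord1; case: (vd j).
split=> //; apply/rowP => i; rewrite derive_mx // mxE.
by case: (vd i).
Qed.

Lemma is_derive_scale a v s (da : R^o) (dv : 'rV[R]_3) :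
  is_derive s 1 a da -> is_derive s 1 v dv ->
  is_derive s 1 (fun t => a t *: v t) (da *: v s + a s *: dv).
Proof.
move=> ad /is_derive_rowP vd; apply/is_derive_rowP => i.
rewrite !mxE; under eq_fun do rewrite mxE.
exact: is_derive_mul.
Qed.

Lemma is_derive_dotv v w s (dv dw : 'rV[R]_3) :
  is_derive s 1 v dv -> is_derive s 1 w dw ->
  is_derive s 1 (fun t => dotv (v t) (w t) : R^o)
    (dotv dv (w s) + dotv (v s) dw).
Proof.
move=> /is_derive_rowP vd /is_derive_rowP wd; rewrite /dotv -big_split /=.
rewrite (_ : (fun t => _) =
  \sum_(i < 3) (fun t => v t 0 i * w t 0 i : R^o)); last first.
  by apply/funext => t; rewrite fct_sumE.
by apply: is_derive_sum => i; exact: is_derive_mul.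
Qed.

Lemma is_derive_crossv v w s (dv dw : 'rV[R]_3) :
  is_derive s 1 v dv -> is_derive s 1 w dw ->
  is_derive s 1 (fun t => crossv (v t) (w t))
    (crossv dv (w s) + crossv (v s) dw).
Proof.
move=> /is_derive_rowP vd /is_derive_rowP wd; apply/is_derive_rowP.
have vwd i j : is_derive s 1
    (fun t => v t 0 i * w t 0 j - v t 0 j * w t 0 i : R^o)
    ((dv 0 i * w s 0 j + v s 0 i * dw 0 j)
     - (dv 0 j * w s 0 i + v s 0 j * dw 0 i)).
  by apply: is_deriveB; exact: is_derive_mul.
apply: ord3P; rewrite mxE; under eq_fun do rewrite crossvE;
  rewrite !crossvE; apply: is_derive_eq; ring.
Qed.

Section OnOpenSet.
Context {I : set R}.
Hypothesis I_open : open I.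

Lemma nderivable_row n v :
  nderivable_on I n v <-> forall i, nderivable_on I n (fun t => v t 0 i : R^o).
Proof.
have coord (u : R -> 'rV[R]_3) : (forall s, I s -> derivable u s 1) -> forall i,
    {in I, derive1 (fun t => u t 0 i : R^o) =1 (fun t => derive1 u t 0 i)}.
  move=> ud i s; rewrite inE => /ud /is_derive_derive1/is_derive_rowP/(_ i).
  by case=> _ <-; rewrite derive1E.
elim: n v => // n IH v; split=> [[vd /IH Cv] i|Cv].
  apply: (nderivable_is_derive I_open (V := R^o) _ (Cv i)) => s /vd.
  by move=> /is_derive_derive1/is_derive_rowP.
have vd s : I s -> derivable v s 1.
  by move=> Is; apply/derivable_mxP => i j; rewrite ord1; exact: (Cv j).1.
split=> //; apply/IH => i.
exact: nderivable_eq_on (coord _ vd i) (Cv i).2.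
Qed.

Lemma nderivable_scale n a v : nderivable_on I n a -> nderivable_on I n v ->
  nderivable_on I n (fun t => a t *: v t).
Proof.
move=> Ca /nderivable_row Cv; apply/nderivable_row => i.
under eq_fun do rewrite mxE.
exact: nderivableM.
Qed.

Lemma nderivable_dotv n v w : nderivable_on I n v -> nderivable_on I n w ->
  nderivable_on I n (fun t => dotv (v t) (w t) : R^o).
Proof.
move=> /nderivable_row Cv /nderivable_row Cw; under eq_fun do rewrite dotvE.
by apply: nderivableD => //; [apply: nderivableD => //|]; apply: nderivableM.
Qed.

Lemma nderivable_crossv n v w : nderivable_on I n v -> nderivable_on I n w ->
  nderivable_on I n (fun t => crossv (v t) (w t)).
Proof.
move=> /nderivable_row Cv /nderivable_row Cw; apply/nderivable_row.
apply: ord3P;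
  under eq_fun do rewrite crossvE; apply: nderivableD => //;
  try apply: nderivableN => //; exact: nderivableM.
Qed.

End OnOpenSet.

End VectorCalculus.

(** * The Frenet equations *)

Section FrenetFrame.
Context {R : realType} {I : set R} {alpha : R -> 'rV[R]_3}.
Hypothesis I_open : open I.
Hypothesis alpha_smooth : smooth_on I alpha.
Hypothesis alpha_unit : unit_speed_on alpha I.
Hypothesis kappa_neq0 : forall s, I s -> curvature alpha s != 0.

Local Notation T := (tangent alpha).
Local Notation N := (normal alpha).
Local Notation B := (binormal alpha).
Local Notation kappa := (curvature alpha).
Local Notation tau := (torsion alpha).

Lemma nderivable_tangent n : nderivable_on I n T.
Proof. exact: ((smooth_onP alpha).1 alpha_smooth n.+1).2. Qed.

(** The square root is differentiable only away from 0, hence the need for a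
    nonvanishing curvature. *)
Lemma nderivable_curvature n : nderivable_on I n (kappa : R -> R^o).
Proof.
have CT' : nderivable_on I n (derive1 T) by exact: (nderivable_tangent n.+1).2.
apply: (nderivable_sqrt I_open) => [s Is|]; last exact: nderivable_dotv.
by rewrite lt_def dotvv_ge0 -enorm_eq0 kappa_neq0.
Qed.

Lemma nderivable_normal n : nderivable_on I n N.
Proof.
apply: (nderivable_scale I_open); last exact: (nderivable_tangent n.+1).2.
by apply: (nderivableV I_open) => //; exact: nderivable_curvature.
Qed.

Lemma nderivable_binormal n : nderivable_on I n B.
Proof.
apply: (nderivable_crossv I_open); first exact: nderivable_tangent.
exact: nderivable_normal.
Qed.

Lemma nderivable_torsion n : nderivable_on I n (tau : R -> R^o).
Proof.
apply: (nderivableN I_open); apply: (nderivable_dotv I_open);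
  last exact: nderivable_normal.
exact: (nderivable_binormal n.+1).2.
Qed.

Lemma is_derive_tangent s : I s -> is_derive s 1 T (kappa s *: N s).
Proof.
move=> Is; rewrite scalerA divff ?kappa_neq0 // scale1r.
by apply: is_derive_derive1; exact: (nderivable_tangent 1).1.
Qed.

Lemma dotv_tangent s : I s -> dotv (T s) (T s) = 1.
Proof. by move=> Is; rewrite -enorm_sqr alpha_unit // expr1n. Qed.

Lemma dotv_normal s : I s -> dotv (N s) (N s) = 1.
Proof.
move=> Is; rewrite dotvZl dotvZr -enorm_sqr -/(curvature alpha s).
by have := kappa_neq0 Is; move: (kappa s) => k k0; field.
Qed.

Lemma dotv_derive_const (v : R -> 'rV[R]_3) c s (dv : 'rV[R]_3) :
  (forall t, I t -> dotv (v t) (v t) = c) -> I s ->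
  is_derive s 1 v dv -> dotv (v s) dv = 0.
Proof.
move=> vc Is vd.
have [_ d1] := is_derive_dotv vd vd.
have [_ d2] : is_derive s 1 (fun t => dotv (v t) (v t) : R^o) (0 : R^o).
  exact: is_derive_const_on vc Is.
by move: d1; rewrite d2 dotvC => /esym; lra.
Qed.

(** Differentiate [dotv T T = 1]. *)
Lemma dotv_tangent_normal s : I s -> dotv (T s) (N s) = 0.
Proof.
move=> Is; have := dotv_derive_const dotv_tangent Is (is_derive_tangent Is).
by rewrite dotvZr => /eqP; rewrite mulf_eq0 (negPf (kappa_neq0 Is)) => /eqP.
Qed.

Lemma crossv_tangent_binormal s : I s -> crossv (T s) (B s) = - N s.
Proof.
move=> Is; rewrite crossv_crossv dotv_tangent // dotv_tangent_normal //.
by rewrite scale0r scale1r sub0r.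
Qed.

(** The three coordinates of [N'] in the Frenet frame come from differentiating
    [dotv T N = 0], [dotv N N = 1] and [B = crossv T N]; the last one turns the
    definition of torsion, a coordinate of [B'], into a coordinate of [N']. *)
Lemma is_derive_normal s : I s ->
  is_derive s 1 N (- kappa s *: T s + tau s *: B s).
Proof.
move=> Is; have Nd : is_derive s 1 N (derive1 N s).
  by apply: is_derive_derive1; exact: (nderivable_normal 1).1.
have Td := is_derive_tangent Is.
have NN' : dotv (derive1 N s) (N s) = 0.
  by rewrite dotvC; exact: dotv_derive_const dotv_normal Is Nd.
have TN' : dotv (derive1 N s) (T s) = - kappa s.
  have [_ d1] := is_derive_dotv Td Nd.
  have [_ d2] : is_derive s 1 (fun t => dotv (T t) (N t) : R^o) (0 : R^o).
    exact: is_derive_const_on dotv_tangent_normal Is.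
  move: d1; rewrite d2 dotvZl dotv_normal // mulr1 (dotvC (T s)) => /esym; lra.
have BN' : dotv (derive1 N s) (B s) = tau s.
  have [_] := is_derive_crossv Td Nd.
  rewrite -derive1E crossvZl crossvv scaler0 add0r /torsion => ->.
  by rewrite dotv_crossv crossvC -scaleN1r dotvZr mulN1r dotvC.
have := orthonormal_expand (derive1 N s) (dotv_tangent Is) (dotv_normal Is)
  (dotv_tangent_normal Is).
by rewrite NN' TN' BN' scale0r addr0 => <-.
Qed.

Lemma is_derive_binormal s : I s -> is_derive s 1 B (- tau s *: N s).
Proof.
move=> Is; have Nd := is_derive_normal Is.
apply: (is_derive_eq (is_derive_crossv (is_derive_tangent Is) Nd)).
rewrite crossvZl crossvv scaler0 add0r crossvDr !crossvZr crossvv scaler0 add0r.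
by rewrite crossv_tangent_binormal // scalerN -scaleNr.
Qed.

End FrenetFrame.

(** * The adapted frame and the fundamental forms *)

(** Together with the tangent and the ruling, this unit vector completes an
    orthonormal frame; it is [- crossv T q]. *)
Definition gnr_conormal {R : realType} (alpha : R -> 'rV[R]_3) (a1 a2 : R -> R)
    (s : R) : 'rV[R]_3 :=
  a2 s *: normal alpha s - a1 s *: binormal alpha s.

(** The denominator [gnr_den] is [- u ^+ 2] times this function of [s] alone
    (see [gnr_denE]), so whether it vanishes at [u != 0] depends only on [s]. *)
Definition gnr_delta {R : realType} (alpha : R -> 'rV[R]_3) (a1 a2 : R -> R)
    (s : R) : R :=
  derive1 (fun t => a1 t * curvature alpha t : R^o) s
  + curvature alpha s * (gnr_f alpha a1 a2 s * a2 s).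

Section GNR.
Context {R : realType} {I : set R} {alpha : R -> 'rV[R]_3} {a1 a2 : R -> R}.
Hypothesis I_open : open I.
Hypothesis alpha_smooth : smooth_on I alpha.
Hypothesis alpha_unit : unit_speed_on alpha I.
Hypothesis kappa_neq0 : forall s, I s -> curvature alpha s != 0.
Hypothesis a1_smooth : smooth_on I (a1 : R -> R^o).
Hypothesis a2_smooth : smooth_on I (a2 : R -> R^o).
Hypothesis a12_unit : forall s, I s -> a1 s ^+ 2 + a2 s ^+ 2 = 1.

Local Notation T := (tangent alpha).
Local Notation N := (normal alpha).
Local Notation B := (binormal alpha).
Local Notation kappa := (curvature alpha).
Local Notation tau := (torsion alpha).
Local Notation q := (gnr_ruling alpha a1 a2).
Local Notation f := (gnr_f alpha a1 a2).
Local Notation g := (gnr_g alpha a1).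
Local Notation F := (gnr_surface alpha a1 a2).
Local Notation C := (gnr_conormal alpha a1 a2).
Local Notation delta := (gnr_delta alpha a1 a2).

Lemma is_derive_smooth {V : normedModType R} (h : R -> V) s :
  smooth_on I h -> I s ->
  is_derive s 1 h (derive1 h s).
Proof. by move=> hs Is; apply: is_derive_derive1; exact: (hs 0%N). Qed.

Lemma is_derive_a1 s : I s -> is_derive s 1 (a1 : R -> R^o) (derive1 a1 s).
Proof. exact: is_derive_smooth. Qed.

Lemma is_derive_a2 s : I s -> is_derive s 1 (a2 : R -> R^o) (derive1 a2 s).
Proof. exact: is_derive_smooth. Qed.

Lemma a12_derive s : I s -> a1 s * derive1 a1 s + a2 s * derive1 a2 s = 0.
Proof.
move=> Is.
have [_ d1] : is_derive s 1 (fun t => a1 t * a1 t + a2 t * a2 t : R^o)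
    ((derive1 a1 s * a1 s + a1 s * derive1 a1 s)
     + (derive1 a2 s * a2 s + a2 s * derive1 a2 s)).
  apply: is_deriveD; apply: is_derive_mul;
    first [exact: is_derive_a1|exact: is_derive_a2].
have [_ d2] : is_derive s 1 (fun t => a1 t * a1 t + a2 t * a2 t : R^o)
    (0 : R^o).
  by apply: (is_derive_const_on I_open (c := 1)) => // t It;
    rewrite -!expr2 a12_unit.
move: d1; rewrite d2 => /esym; lra.
Qed.

(** As [(a1, a2)] runs on the unit circle, [(a1', a2')] is [a1' a2 - a1 a2']
    times [(a2, - a1)]. Hence the [N] and [B] coordinates of [q'] are
    proportional to those of [C], with factor [f]; likewise in the next lemma. *)
Lemma gnr_f_a2 s : I s -> derive1 a1 s - a2 s * tau s = f s * a2 s.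
Proof.
move=> Is; have := a12_unit Is; have := a12_derive Is; rewrite /gnr_f.
move: (derive1 a1 s) (derive1 a2 s) (a1 s) (a2 s) (tau s) => d1 d2 x y t h0 h1.
have -> : (d1 * y - x * d2 - t) * y
  = d1 * (x ^+ 2 + y ^+ 2) - x * (x * d1 + y * d2) - y * t by ring.
by rewrite h0 h1; ring.
Qed.

Lemma gnr_f_a1 s : I s -> derive1 a2 s + a1 s * tau s = - (f s * a1 s).
Proof.
move=> Is; have := a12_unit Is; have := a12_derive Is; rewrite /gnr_f.
move: (derive1 a1 s) (derive1 a2 s) (a1 s) (a2 s) (tau s) => d1 d2 x y t h0 h1.
have -> : - ((d1 * y - x * d2 - t) * x)
  = d2 * (x ^+ 2 + y ^+ 2) - y * (x * d1 + y * d2) + x * t by ring.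
by rewrite h0 h1; ring.
Qed.

Lemma nderivable_gnr_f n : nderivable_on I n (f : R -> R^o).
Proof.
have Ca1 m : nderivable_on I m (a1 : R -> R^o) by apply: (smooth_onP _).1.
have Ca2 m : nderivable_on I m (a2 : R -> R^o) by apply: (smooth_onP _).1.
apply: (nderivableD I_open).
  apply: (nderivableD I_open (V := R^o)).
    by apply: (nderivableM I_open) => //; exact: (Ca1 n.+1).2.
  apply: (nderivableN I_open (V := R^o)).
  by apply: (nderivableM I_open) => //; exact: (Ca2 n.+1).2.
by apply: (nderivableN I_open (V := R^o)); exact: nderivable_torsion.
Qed.

Lemma is_derive_ruling s : I s ->
  is_derive s 1 q (- (a1 s * kappa s) *: T s + f s *: C s).
Proof.
move=> Is; apply: is_derive_eq.
  apply: is_deriveD; apply: is_derive_scale.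
  - exact: is_derive_a1.
  - exact: (is_derive_normal I_open alpha_smooth alpha_unit kappa_neq0 Is).
  - exact: is_derive_a2.
  - exact: (is_derive_binormal I_open alpha_smooth alpha_unit kappa_neq0 Is).
have -> : f s *: C s = (f s * a2 s) *: N s - (f s * a1 s) *: B s.
  by rewrite scalerBr !scalerA.
rewrite -[- (_ *: B s)]scaleNr -gnr_f_a1 // -gnr_f_a2 //.
by apply/rowP => i; rewrite !mxE; ring.
Qed.

Lemma is_derive_conormal s : I s ->
  is_derive s 1 C (- (a2 s * kappa s) *: T s - f s *: q s).
Proof.
move=> Is; apply: is_derive_eq.
  apply: is_deriveB; apply: is_derive_scale.
  - exact: is_derive_a2.
  - exact: (is_derive_normal I_open alpha_smooth alpha_unit kappa_neq0 Is).
  - exact: is_derive_a1.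
  - exact: (is_derive_binormal I_open alpha_smooth alpha_unit kappa_neq0 Is).
have -> : - (f s *: q s) = - (f s * a1 s) *: N s - (f s * a2 s) *: B s.
  by apply/rowP => i; rewrite !mxE; ring.
rewrite -gnr_f_a1 // -gnr_f_a2 //.
by apply/rowP => i; rewrite !mxE; ring.
Qed.

Lemma curvature_normal_ruling s : I s ->
  kappa s *: N s = (a1 s * kappa s) *: q s + (a2 s * kappa s) *: C s.
Proof.
move=> Is; rewrite -[in LHS](mulr1 (kappa s)) -(a12_unit Is).
by apply/rowP => i; rewrite !mxE; ring.
Qed.

Lemma dotv_ruling s : I s ->
  [/\ dotv (T s) (q s) = 0, dotv (T s) (C s) = 0, dotv (q s) (q s) = 1,
      dotv (q s) (C s) = 0 & dotv (C s) (C s) = 1].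
Proof.
move=> Is; have TT := dotv_tangent alpha_unit Is.
have NN := dotv_normal kappa_neq0 Is.
have TN := dotv_tangent_normal I_open alpha_smooth alpha_unit kappa_neq0 Is.
have TB : dotv (T s) (B s) = 0 by rewrite dotv_crossv crossvv !dotvE !mxE; ring.
have NB : dotv (N s) (B s) = 0.
  by rewrite dotv_crossv dotv_crossv crossvv !dotvE !mxE; ring.
have BB : dotv (B s) (B s) = 1 by rewrite dotv_crossvv TT NN TN; ring.
have a12 := a12_unit Is.
rewrite /gnr_ruling /gnr_conormal -scaleNr.
(* [N] unfolds to a scaling, which the bilinearity rules would expand. *)
move: (T s) (N s) (B s) TT NN TN TB NB BB => t n b TT NN TN TB NB BB.
rewrite !(dotvDl, dotvDr, dotvZl, dotvZr) (dotvC b n) TN TB NN NB BB.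
by split; rewrite ?(mulr0, mulr1, addr0, add0r) // -?a12; ring.
Qed.

Lemma crossv_tangent_ruling s : I s -> crossv (T s) (q s) = - C s.
Proof.
move=> Is; rewrite /gnr_ruling crossvDr 2!crossvZr.
rewrite (crossv_tangent_binormal I_open alpha_smooth alpha_unit kappa_neq0 Is).
by rewrite /gnr_conormal scalerN opprB.
Qed.

Lemma crossv_conormal_ruling s : I s -> crossv (C s) (q s) = T s.
Proof.
move=> Is; have [Tq _ qq _ _] := dotv_ruling Is.
rewrite -[C s]opprK -crossv_tangent_ruling // -scaleN1r crossvZl scaleN1r.
by rewrite -crossvC crossv_crossv qq dotvC Tq scale1r scale0r subr0.
Qed.

Lemma dotv_frame s (x y z x' y' z' : R) : I s ->
  dotv (x *: T s + y *: q s + z *: C s) (x' *: T s + y' *: q s + z' *: C s)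
  = x * x' + y * y' + z * z'.
Proof.
move=> Is; have [Tq TC qq qC CC] := dotv_ruling Is.
have TT := dotv_tangent alpha_unit Is.
move: (T s) (q s) (C s) TT Tq TC qq qC CC => t p c TT Tq TC qq qC CC.
rewrite !(dotvDl, dotvDr, dotvZl, dotvZr) (dotvC p t) (dotvC c t) (dotvC c p).
by rewrite TT Tq TC qq qC CC; ring.
Qed.

Lemma pd2_gnr s u : pd2 F s u = q s.
Proof.
have ud : is_derive u 1 (fun t : R => t : R^o) (1 : R^o) by exact: is_derive_id.
rewrite /pd2 derive1E.
have [_ ->] := is_deriveD (is_derive_cst (alpha s) u 1)
  (is_derive_scale ud (is_derive_cst (q s) u 1)).
by rewrite add0r scale1r scaler0 addr0.
Qed.

Lemma pd22_gnr s u : pd2 (pd2 F) s u = 0.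
Proof.
rewrite /pd2 (_ : (fun t => _) = cst (q s)) ?derive1_cst //.
by apply/funext => t; exact: pd2_gnr.
Qed.

Lemma pd1_gnr s u : I s -> pd1 F s u = g s u *: T s + (u * f s) *: C s.
Proof.
move=> Is.
have alphad : is_derive s 1 alpha (T s).
  exact: is_derive_smooth.
rewrite /pd1 derive1E.
have [_ ->] := is_deriveD alphad
  (is_derive_scale (is_derive_cst (u : R^o) s 1) (is_derive_ruling Is)).
by apply/rowP => i; rewrite /gnr_g !mxE /cst; ring.
Qed.

Lemma is_derive_gnr_g s u : I s ->
  is_derive s 1 (fun t => g t u : R^o)
    (- (u * derive1 (fun t => a1 t * kappa t : R^o) s)).
Proof.
move=> Is.
have kd : is_derive s 1 (kappa : R -> R^o) (derive1 kappa s).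
  apply: is_derive_derive1.
  exact: (nderivable_curvature I_open alpha_smooth kappa_neq0 1).1.
have ckd : is_derive s 1 (fun t => a1 t * kappa t : R^o)
    (derive1 (fun t => a1 t * kappa t : R^o) s).
  apply: is_derive_derive1.
  by have [] := is_derive_mul (is_derive_a1 Is) kd.
have gE : (fun t => g t u : R^o) =
    (fun t => cst (1 : R^o) t - cst (u : R^o) t * (a1 t * kappa t) : R^o).
  by apply/funext => t; rewrite /gnr_g /cst /= mulrA.
rewrite gE; apply: is_derive_eq (is_deriveB (is_derive_cst (1 : R^o) s 1)
  (is_derive_mul (is_derive_cst (u : R^o) s 1) ckd)) _.
by rewrite /cst mul0r !add0r.
Qed.

Lemma derive1_gnr_g s u : I s -> derive1 (fun t => g t u) s =
  - (u * derive1 (fun t => a1 t * kappa t : R^o) s).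
Proof. by move=> Is; rewrite derive1E; case: (is_derive_gnr_g u Is). Qed.

Lemma gnr_denE s u : I s -> gnr_den alpha a1 a2 s u = - (u ^+ 2 * delta s).
Proof.
by move=> Is; rewrite /gnr_den derive1_gnr_g // gnr_f_a2 // /gnr_delta; ring.
Qed.

Lemma pd11_gnr s u : I s -> pd1 (pd1 F) s u =
  - (u * delta s) *: T s
  + (g s u * (a1 s * kappa s) - u * f s ^+ 2) *: q s
  + (a2 s * kappa s * g s u + u * derive1 f s) *: C s.
Proof.
move=> Is.
have fd : is_derive s 1 (f : R -> R^o) (derive1 f s).
  by apply: is_derive_derive1; exact: (nderivable_gnr_f 1).1.
have Td := is_derive_tangent alpha_smooth kappa_neq0 Is.
have := is_deriveD (is_derive_scale (is_derive_gnr_g u Is) Td)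
  (is_derive_scale (is_derive_mul (is_derive_cst (u : R^o) s 1) fd)
     (is_derive_conormal Is)).
move=> /(is_derive_eq_on I_open (g := fun t => pd1 F t u)) []// => [t|_].
  by rewrite inE => It; rewrite pd1_gnr.
move=> d; apply: etrans (derive1E _ _) _.
rewrite d curvature_normal_ruling // /gnr_delta /cst.
move: (T s) (q s) (C s) => t p c.
by apply/rowP => i; rewrite !mxE; ring.
Qed.

Lemma gnr_first_form s u : I s ->
  [/\ ffE F s u = g s u ^+ 2 + (u * f s) ^+ 2, ffF F s u = 0 & ffG F s u = 1].
Proof.
move=> Is.
have FsE : pd1 F s u = g s u *: T s + 0 *: q s + (u * f s) *: C s.
  by rewrite pd1_gnr // scale0r addr0.
have FuE : pd2 F s u = 0 *: T s + 1 *: q s + 0 *: C s.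
  by rewrite pd2_gnr !scale0r scale1r add0r addr0.
rewrite /ffE /ffF /ffG FsE FuE !dotv_frame //.
by split; ring.
Qed.

Lemma gnr_cross s u : I s ->
  crossv (pd1 F s u) (pd2 F s u) =
  (u * f s) *: T s + 0 *: q s + - g s u *: C s.
Proof.
move=> Is; rewrite pd1_gnr // pd2_gnr crossvDl 2!crossvZl.
rewrite crossv_tangent_ruling // crossv_conormal_ruling //.
by rewrite scale0r addr0 scalerN scaleNr addrC.
Qed.

(** Since the unit normal is a rescaled cross product of the two first
    derivatives, [ffL] is the dot product of the vectors in [pd11_gnr] and
    [gnr_cross], up to a factor that is nonzero at regular points. *)
Lemma gnr_ffL s u : I s ->
  ffL F s u = (enorm (crossv (pd1 F s u) (pd2 F s u)))^-1 *
    (f s * gnr_den alpha a1 a2 s u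
     - g s u * (a2 s * kappa s * g s u + u * derive1 f s)).
Proof.
move=> Is; rewrite /ffL /unit_normal dotvZr; congr (_ * _).
by rewrite gnr_cross // pd11_gnr // dotv_frame // gnr_denE //; ring.
Qed.

(** At a regular point the equation is [ffL = 0]. At the other points both [g]
    and [u * f] vanish, and so do both sides, since [gnr_den] is a multiple of
    [u]: the equation thus holds on the whole parameter domain, which makes it
    a polynomial identity in [u]. *)
Lemma gnr_minimalP : minimal_on F (I `*` [set: R]) <->
  forall s u, I s -> f s * gnr_den alpha a1 a2 s u =
    g s u * (a2 s * kappa s * g s u + u * derive1 f s).
Proof.
have H s u : I s -> mean_curvature F s u =
    ffL F s u / (2 * (g s u ^+ 2 + (u * f s) ^+ 2)).
  move=> Is; have [E0 F0 G0] := gnr_first_form u Is.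
  rewrite /mean_curvature E0 F0 G0 /ffN pd22_gnr.
  rewrite (_ : dotv 0 _ = 0); last by rewrite dotvE !mxE; ring.
  by congr (_ / _); ring.
have reg s u : I s -> regular_at F s u <-> g s u ^+ 2 + (u * f s) ^+ 2 != 0.
  move=> Is; have [E0 F0 G0] := gnr_first_form u Is.
  by rewrite /regular_at E0 F0 G0 mulr1 expr0n subr0.
split=> [Fmin s u Is|Fmin s u [Is _] sreg]; last first.
  by rewrite H // gnr_ffL // Fmin // subrr mulr0 mul0r.
have [gf0|gf0] := eqVneq (g s u ^+ 2 + (u * f s) ^+ 2) 0.
  move/eqP: gf0; rewrite paddr_eq0 ?sqr_ge0 // !sqrf_eq0.
  move=> /andP[/eqP g0 /eqP f0].
  rewrite g0 mul0r gnr_denE //.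
  rewrite (_ : f s * _ = - (u * f s * (u * delta s))); last by ring.
  by rewrite f0 mul0r oppr0.
have := Fmin s u (conj Is Logic.I) ((reg s u Is).2 gf0).
rewrite H // => /eqP.
rewrite mulf_eq0 invr_eq0 mulf_eq0 pnatr_eq0 (negPf gf0) /= orbF.
rewrite gnr_ffL // mulf_eq0 invr_eq0 enorm_eq0 gnr_cross // dotv_frame //.
rewrite (_ : _ + _ + _ = g s u ^+ 2 + (u * f s) ^+ 2); last by ring.
by rewrite (negPf gf0) /= subr_eq0 => /eqP.
Qed.

End GNR.

(** * Rigidity of the two equations *)

Section Rigidity.
Context {R : realType}.
Implicit Types b c d f k x y z : R.

(** The values at [u = 0, 1, -1] already determine the coefficients. *)
Lemma minimal_coef_eq0 b c d f f' :
  (forall u, f * - (u ^+ 2 * d) = (1 - u * c) * (b * (1 - u * c) + u * f')) ->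
  [/\ b = 0, f' = 0 & f * d = 0].
Proof.
move=> H; have b0 : b = 0 by have := H 0; rewrite expr2 !mul0r; lra.
have := H 1; have := H (-1); rewrite sqrrN expr1n b0 => H1 H2.
have f'0 : f' = 0 by lra.
by split=> //; move: H1; rewrite f'0; lra.
Qed.

(** On one side of 0, depending on the sign of [c], no point is excluded. *)
Lemma quadratic_eq0 x y z c :
  (forall u, u != 0 -> 1 - u * c != 0 -> x + y * u + z * u ^+ 2 = 0) ->
  [/\ x = 0, y = 0 & z = 0].
Proof.
move=> H; have [c0|c0] := leP c 0.
  have P u : 0 < u -> x + y * u + z * u ^+ 2 = 0.
    by move=> u0; apply: H; rewrite gt_eqF //; nra.
  have := P 1; have := P 2; have := P 3; rewrite !expr2.
  by move=> /(_ ltac:(lra)) ? /(_ ltac:(lra)) ? /(_ ltac:(lra)) ?; split; lra.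
have P u : u < 0 -> x + y * u + z * u ^+ 2 = 0.
  by move=> u0; apply: H; [rewrite lt_eqF|rewrite gt_eqF //; nra].
have := P (-1); have := P (-2); have := P (-3); rewrite !expr2.
by move=> /(_ ltac:(lra)) ? /(_ ltac:(lra)) ? /(_ ltac:(lra)) ?; split; lra.
Qed.

(** Here [x, y] stand for [a1, a2]. The coefficient of [u ^+ 0] gives
    [y * (kappa + tau * f * x) = 0]. If [y] were nonzero, then [f] and [x] would
    be nonzero as well, and at the root [(x * kappa)^-1] of the right-hand side
    the left-hand side would not vanish. With [y = 0] the remaining coefficients
    give [f' = 0] and [f * d = 0]. *)
Lemma quotient_coef_eq0 (x y kappa tau d f f' : R) :
  kappa != 0 -> d != 0 ->
  (forall u, u != 0 -> 1 - u * x * kappa != 0 ->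
     f * - (u ^+ 2 * d) = (1 - u * x * kappa) *
       (- (y * kappa * (1 - u * x * kappa)) + y * tau * - (f * x)
        + u * (- f' + x * tau * (f * y)))) ->
  y = 0 /\ f = 0.
Proof.
move=> k0 d0 H.
(* The difference of the two sides is quadratic in [u]. *)
have {}H u : f * - (u ^+ 2 * d) = (1 - u * x * kappa) *
       (- (y * kappa * (1 - u * x * kappa)) + y * tau * - (f * x)
        + u * (- f' + x * tau * (f * y))).
  set c := x * kappa; set b := y * kappa; set k := y * tau * (f * x).
  have [|A0 B0 C0] := @quadratic_eq0 (b + k)
      (- (b * c - f' + k) - c * (b + k)) (c * (b * c - f' + k) - f * d) c.
    move=> v v0 vc; have := H v v0; rewrite -mulrA => /(_ vc) => /eqP.
    rewrite -subr_eq0 => /eqP <-; rewrite /b /c /k; ring.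
  apply/eqP; rewrite -subr_eq0; apply/eqP.
  transitivity ((b + k) + (- (b * c - f' + k) - c * (b + k)) * u
    + (c * (b * c - f' + k) - f * d) * u ^+ 2).
    by rewrite /b /c /k; ring.
  by rewrite C0 B0 A0; ring.
have y0 : y = 0.
  apply: contraTeq isT => y0.
  have kE : kappa = - (tau * f * x).
    apply: (mulfI y0); have := H 0; rewrite expr2 !mul0r; lra.
  have f0 : f != 0 by apply: contraNneq k0 => f0; rewrite kE f0; lra.
  have x0 : x != 0 by apply: contraNneq k0 => x0; rewrite kE x0; lra.
  have /eqP := H (x * kappa)^-1.
  rewrite -[_ * x * _]mulrA mulVf ?mulf_neq0 // subrr mul0r mulf_eq0 (negPf f0).
  rewrite oppr_eq0 mulf_eq0 (negPf d0) sqrf_eq0 invr_eq0 mulf_eq0.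
  by rewrite (negPf x0) (negPf k0).
split=> //; have := H 1; have := H (-1); rewrite y0 sqrrN expr1n => H1 H2.
have f'0 : f' = 0 by lra.
have /eqP : f * d = 0 by move: H1; rewrite f'0; lra.
by rewrite mulf_eq0 (negPf d0) orbF => /eqP.
Qed.

End Rigidity.

(** Vanishing on a set of surface points passes to the parameters [s] in the
    projection of its closure, for a continuous function of [s]. *)
Lemma closure_proj_eq0 (R : realType) (A : set (R * R)) (h : R -> R^o)
    (s u : R) :
  closure A (s, u) -> {for s, continuous h} ->
  (forall p, A p -> h p.1 = 0) -> h s = 0.
Proof.
move=> Asu hs h0; apply: contraTeq isT => hs0.
have /cvgr_neq0/(_ hs0) : h (p : R * R).1 @[p --> (s, u)] --> h s.
  by apply: (cvg_comp _ h _ hs); exact: cvg_fst.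
by move=> /Asu[p [/h0 ->]]; rewrite /= eqxx.
Qed.

Unset Implicit Arguments.

Theorem proposition3p11 (R : realType) (I : set R)
    (alpha : R -> 'rV[R]_3) (a1 a2 : R -> R)
    (I_open : open I) (I_interval : is_interval I)
    (alpha_smooth : smooth_on I alpha)
    (alpha_unit : unit_speed_on alpha I)
    (kappa_neq0 : forall s, I s -> curvature alpha s != 0)
    (a1_smooth : smooth_on I (a1 : R -> R^o))
    (a2_smooth : smooth_on I (a2 : R -> R^o))
    (a12_unit : forall s, I s -> a1 s ^+ 2 + a2 s ^+ 2 = 1)
    (* the two quotients make sense at generic points of the surface *)
    (generic : I `*` [set: R] `<=`
       closure [set p | I p.1 /\ gnr_defined alpha a1 a2 p.1 p.2]) :
  minimal_on (gnr_surface alpha a1 a2) (I `*` [set: R]) <->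
  (forall s u, I s -> gnr_defined alpha a1 a2 s u ->
     gnr_f alpha a1 a2 s / gnr_g alpha a1 s u =
     gnr_num alpha a1 a2 s u / gnr_den alpha a1 a2 s u).
Proof.
have minP := gnr_minimalP I_open alpha_smooth alpha_unit kappa_neq0 a1_smooth
  a2_smooth a12_unit.
have denE := gnr_denE I_open alpha_smooth kappa_neq0 a1_smooth a2_smooth
  a12_unit.
have numE s u : I s -> gnr_num alpha a1 a2 s u =
    - (a2 s * curvature alpha s * gnr_g alpha a1 s u)
    + a2 s * torsion alpha s * - (gnr_f alpha a1 a2 s * a1 s)
    + u * (- derive1 (gnr_f alpha a1 a2) s
           + a1 s * torsion alpha s * (gnr_f alpha a1 a2 s * a2 s)).
  move=> Is; rewrite /gnr_num (gnr_f_a1 I_open a1_smooth a2_smooth a12_unit) //.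
  by rewrite (gnr_f_a2 I_open a1_smooth a2_smooth a12_unit).
apply: (iff_trans minP); split=> [H s u Is [g0 den0]|H].
  have [|/eqP b0 f'0 /eqP fd0] := @minimal_coef_eq0 _ (a2 s * curvature alpha s)
      (a1 s * curvature alpha s) (gnr_delta alpha a1 a2 s)
      (gnr_f alpha a1 a2 s) (derive1 (gnr_f alpha a1 a2) s).
    by move=> v; rewrite -denE // H // /gnr_g mulrA.
  have a20 : a2 s = 0.
    by move: b0; rewrite mulf_eq0 (negPf (kappa_neq0 s Is)) orbF => /eqP.
  move: den0; rewrite denE // oppr_eq0 mulf_eq0 negb_or => /andP[_ d0].
  have f0 : gnr_f alpha a1 a2 s = 0.
    by move: fd0; rewrite mulf_eq0 (negPf d0) orbF => /eqP.
  rewrite numE // f0 f'0 a20; ring.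
(* [gnr_delta s] is nonzero, so the quotients at [s] are defined for every
   [u != 0] with [g s u != 0], and the hypothesis may be used for all of them. *)
have zero s : I s -> (exists u, gnr_defined alpha a1 a2 s u) ->
    a2 s = 0 /\ gnr_f alpha a1 a2 s = 0.
  move=> Is [u [_]]; rewrite denE // oppr_eq0 mulf_eq0 negb_or => /andP[_ d0].
  apply: (@quotient_coef_eq0 _ (a1 s) (a2 s) (curvature alpha s)
    (torsion alpha s) (gnr_delta alpha a1 a2 s) _
    (derive1 (gnr_f alpha a1 a2) s)) => // [|v v0 g0]; first exact: kappa_neq0.
  have den0 : gnr_den alpha a1 a2 s v != 0.
    by rewrite denE // oppr_eq0 mulf_neq0 // sqrf_eq0.
  have := H s v Is (conj g0 den0); move/eqP; rewrite eqr_div // => /eqP.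
  by rewrite denE // numE // => ->; rewrite mulrC.
have continuous_zero (h : R -> R^o) : nderivable_on I 1 h ->
    (forall s, I s -> (exists u, gnr_defined alpha a1 a2 s u) -> h s = 0) ->
    forall s, I s -> h s = 0.
  move=> [hd _] h0 s Is.
  apply: (closure_proj_eq0 (u := 0) (generic (s, 0) _)) => //.
    exact/differentiable_continuous/derivable1_diffP/hd.
  by move=> [t v] /= [It tv]; apply: h0 => //; exists v.
have a20 : forall s, I s -> a2 s = 0.
  apply: continuous_zero => [|s Is su]; last by case: (zero s Is su).
  exact: (smooth_onP _).1.
have f0 : forall s, I s -> gnr_f alpha a1 a2 s = 0.
  apply: continuous_zero => [|s Is su]; last by case: (zero s Is su).
  exact: nderivable_gnr_f.
move=> s u Is; rewrite f0 // a20 // derive1E.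
have [_ ->] := is_derive_const_on I_open f0 Is.
by ring.
Qed.
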